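(* Let $V=\{v\in\mathbb{R}^N: v_1=v_N=0\}$. Consider the semi-discrete Dirichlet problem for the unknown $\bar u^0(t)\in V$, $$RHPR\,\bar u^0_{tt}-RHD^-PC^2D^+R\,\bar u^0=RHR\bar f+RHD^-PC^2D^+\bar d,\qquad \bar u^0(0)=\bar u^0_t(0)=0,$$ where $R=\mathrm{diag}(0,1,\dots,1,0)$, $\bar d=(a_L(t),0,\dots,0,a_R(t))^T$, $a_L,a_R$ are the Dirichlet data at $x=0$ and $x=1$, and $\bar f(t)\in\mathbb{R}^N$. Put $G=RHP$ (diagonal) and $A=-RHD^-PC^2D^+R$, and let $F(t)$ denote the right-hand side of the equation. Then $A$ is symmetric and positive definite on $V$, and the explicit scheme on $V$ $$G\,\frac{u^{k+1}-2u^k+u^{k-1}}{\tau^2}+Au^k=F^k,\quad k=1,2,\dots,\qquad u^0=u^1=0,\quad F^k=F(k\tau),$$ is stable under the condition $\tau\le 2/\sqrt{(1+\varepsilon)\lambda_{\max}}$, $\varepsilon>0$. That is, if $0<\lambda_{\min}\le\lambda_{\max}$ are such that $\lambda_{\min}(Gv,v)\le(Av,v)\le\lambda_{\max}(Gv,v)$ for all $v\in V$, then for every $\varepsilon>0$ there is a constant $K>0$, independent of $k$, $\tau$ and $F$, such that for every $\tau>0$ satisfying the condition, $$\|u^{k+1}\|_G\le\frac{K}{\lambda_{\min}}\sqrt{\frac{1+\varepsilon}{\varepsilon}}\sum_{i=1}^k\tau\|F^i\|_G,\qquad k\ge1 .$$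
   Context: The continuous problem is the wave equation $\rho\,\partial_t^2u-\partial_x(\rho c^2\partial_xu)=f$ on $[0,1]$, with smooth positive $\rho(x),c(x)$, zero initial data, and boundary conditions $u|_{x=0}=a_L(t)$, $u|_{x=1}=a_R(t)$. Grid: $0=x_1<x_2<\dots<x_N=1$. $P=\mathrm{diag}(\rho(x_n))$ and $C=\mathrm{diag}(c(x_n))$ are positive diagonal $N\times N$ matrices. $H$ is a diagonal $N\times N$ matrix with positive entries, and $(u,v)_H=v^THu$. $D^+,D^-$ are $N\times N$ matrices approximating $\partial/\partial x$ at all grid points and satisfying the summation-by-parts (SBP) condition $$(u,D^+v)_H+(D^-u,v)_H=-u_1v_1+u_Nv_N\qquad\forall u,v\in\mathbb{R}^N .$$ The kernel of $D^+$ consists exactly of the constant vectors. $(u,v)=v^Tu$ is the Euclidean scalar product and $\|v\|_G=(Gv,v)^{1/2}$. *)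

(* Defs.v *)
From HB Require Import structures.
From mathcomp Require Import all_boot all_order all_algebra.
From mathcomp Require Import all_classical all_reals all_analysis.
Import Order.TTheory GRing.Theory Num.Theory.
Import numFieldNormedType.Exports.

Set Implicit Arguments.
Unset Strict Implicit.
Unset Printing Implicit Defensive.

Local Open Scope ring_scope.

(* A mesh of N = n.+2 points: the first is [ord0], the last [ord_max]. *)

(* C^oo on the closed interval [0,1], in the sense of being the restriction
   of a C^oo function on the whole line. *)
Definition smooth01 (R : realType) (f : R -> R) : Prop :=
  exists2 g : R -> R,
    forall (k : nat) (y : R), derivable (derive1n k g : R -> R) y 1 &
    forall y : R, 0 <= y <= 1 -> f y = g y.

Definition is_grid (R : realType) (n : nat) (x : 'I_n.+2 -> R) : Prop :=
  [/\ x ord0 = 0, x ord_max = 1 &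
      forall i j : 'I_n.+2, (i < j)%N -> x i < x j].

Definition grid_diag (R : realType) (n : nat) (x : 'I_n.+2 -> R) (g : R -> R)
    : 'M[R]_n.+2 :=
  diag_mx (\row_i g (x i)).

Definition dot (R : realType) (n : nat) (u v : 'cV[R]_n) : R :=
  (v^T *m u) 0 0.

Definition dotH (R : realType) (n : nat) (H : 'M[R]_n) (u v : 'cV[R]_n) : R :=
  (v^T *m H *m u) 0 0.

Definition normG (R : realType) (n : nat) (G : 'M[R]_n) (v : 'cV[R]_n) : R :=
  Num.sqrt (dot (G *m v) v).

Definition SBP (R : realType) (n : nat) (H Dp Dm : 'M[R]_n.+2) : Prop :=
  forall u v : 'cV[R]_n.+2,
    dotH H u (Dp *m v) + dotH H (Dm *m u) v =
    - (u ord0 0 * v ord0 0) + u ord_max 0 * v ord_max 0.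

Definition kernel_is_constants (R : realType) (n : nat) (D : 'M[R]_n) : Prop :=
  forall v : 'cV[R]_n, D *m v = 0 <-> exists a : R, v = const_mx a.

Definition Vspace (R : realType) (n : nat) (v : 'cV[R]_n.+2) : Prop :=
  v ord0 0 = 0 /\ v ord_max 0 = 0.

Definition Rmx (R : realType) (n : nat) : 'M[R]_n.+2 :=
  diag_mx (\row_i (if (i == ord0) || (i == ord_max) then 0 else 1)).

Definition dirichlet_data (R : realType) (n : nat) (aL aR : R -> R) (t : R)
    : 'cV[R]_n.+2 :=
  \col_i (if i == ord0 then aL t else if i == ord_max then aR t else 0).

Definition Gmx (R : realType) (n : nat) (H P : 'M[R]_n.+2) : 'M[R]_n.+2 :=
  Rmx R n *m H *m P.

Definition Amx (R : realType) (n : nat) (H P C Dp Dm : 'M[R]_n.+2)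
    : 'M[R]_n.+2 :=
  - (Rmx R n *m H *m Dm *m P *m C ^+ 2 *m Dp *m Rmx R n).

(* Right-hand side of the semi-discrete problem
     R H P R u'' - R H D^- P C^2 D^+ R u = F(t)
   with Dirichlet data aL, aR. *)
Definition rhs (R : realType) (n : nat) (H P C Dp Dm : 'M[R]_n.+2)
    (f : R -> 'cV[R]_n.+2) (aL aR : R -> R) (t : R) : 'cV[R]_n.+2 :=
  Rmx R n *m H *m Rmx R n *m f t +
  Rmx R n *m H *m Dm *m P *m C ^+ 2 *m Dp *m dirichlet_data n aL aR t.

Definition symmetric_on (R : realType) (n : nat) (W : 'cV[R]_n -> Prop)
    (A : 'M[R]_n) : Prop :=
  forall u v : 'cV[R]_n, W u -> W v -> dot (A *m u) v = dot u (A *m v).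

Definition posdef_on (R : realType) (n : nat) (W : 'cV[R]_n -> Prop)
    (A : 'M[R]_n) : Prop :=
  forall v : 'cV[R]_n, W v -> v != 0 -> 0 < dot (A *m v) v.

(* A solution in V of the explicit leap-frog scheme with time step tau. *)
Definition explicit_scheme (R : realType) (n : nat) (G A : 'M[R]_n.+2)
    (F : R -> 'cV[R]_n.+2) (tau : R) (u : nat -> 'cV[R]_n.+2) : Prop :=
  [/\ forall k : nat, Vspace (u k),
      u 0%N = 0, u 1%N = 0 &
      forall k : nat, (1 <= k)%N ->
        G *m ((tau ^+ 2)^-1 *: (u k.+1 - u k *+ 2 + u k.-1)) + A *m u k =
        F (k%:R * tau)].

(* Main.v *)
Require Import Defs.
From HB Require Import structures.
From mathcomp Require Import all_boot all_order all_algebra.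
From mathcomp Require Import all_classical all_reals all_analysis.
From mathcomp Require Import ring lra.
Import Order.TTheory GRing.Theory Num.Theory.
Import numFieldNormedType.Exports.

Set Implicit Arguments.
Unset Strict Implicit.
Unset Printing Implicit Defensive.

Local Open Scope ring_scope.


(** For u, v vanishing at both ends, summation by parts turns (A u, v) into
    the diagonally weighted product (H P C^2 D^+ u, D^+ v) with positive
    weights [dot_Amx].  Hence A is symmetric and nonnegative on V, and
    (A v, v) = 0 forces D^+ v = 0, so v is constant and, vanishing at an end,
    zero.

    Stability is an energy argument.  With d^k = (u^{k+1} - u^k) / tau, the
    quantity E_k = (G d^k, d^k) + (A u^{k+1}, u^k) changes in one step by
    exactly tau (F^k, d^k + d^{k-1}) [energy_balance].  It is a priori
    indefinite, but the time step restriction gives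
    (1 + eps) tau^2 / 4 (A v, v) <= (G v, v), and then both (A u^{k+1}, u^{k+1})
    and (G d^k, d^k) are at most (1 + eps) / eps * E_k [potential_le_energy,
    kinetic_le_energy].  Bounding the work of F^k by
    kappa |F^k|_G (|d^k|_G + |d^{k-1}|_G) and factoring the difference
    E_k - E_{k-1} of two squares, sqrt E_k increases per step by at most
    kappa sqrt((1 + eps) / eps) tau |F^k|_G [sqrt_energy_step].  Summing from
    E_0 = 0 and using lmin |u^{k+1}|_G^2 <= (A u^{k+1}, u^{k+1}) gives the
    estimate with K = kappa sqrt((1 + eps) / eps) sqrt lmin.  The constant
    kappa compares the Euclidean pairing with the G-norm on V; it depends on
    the interior weights of G only [dot_le_normG]. *)

(** * The Euclidean form and diagonal weights *)

Lemma dotE (R : realType) (m : nat) (u v : 'cV[R]_m) :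
  dot u v = \sum_i u i 0 * v i 0.
Proof. by rewrite /dot mxE; apply: eq_bigr => i _; rewrite mxE mulrC. Qed.

Lemma dotC (R : realType) (m : nat) (u v : 'cV[R]_m) : dot u v = dot v u.
Proof. by rewrite !dotE; apply: eq_bigr => i _; rewrite mulrC. Qed.

Lemma dotDl (R : realType) (m : nat) (u v w : 'cV[R]_m) :
  dot (u + v) w = dot u w + dot v w.
Proof. by rewrite /dot mulmxDr mxE. Qed.

Lemma dotZl (R : realType) (m : nat) (a : R) (u w : 'cV[R]_m) :
  dot (a *: u) w = a * dot u w.
Proof. by rewrite /dot -scalemxAr mxE. Qed.

Lemma dotDr (R : realType) (m : nat) (u v w : 'cV[R]_m) :
  dot w (u + v) = dot w u + dot w v.
Proof. by rewrite !(dotC w) dotDl. Qed.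

Lemma dotZr (R : realType) (m : nat) (a : R) (u w : 'cV[R]_m) :
  dot w (a *: u) = a * dot w u.
Proof. by rewrite !(dotC w) dotZl. Qed.

Lemma dotNl (R : realType) (m : nat) (u w : 'cV[R]_m) :
  dot (- u) w = - dot u w.
Proof. by rewrite -scaleN1r dotZl mulN1r. Qed.

Lemma dotNr (R : realType) (m : nat) (u w : 'cV[R]_m) :
  dot w (- u) = - dot w u.
Proof. by rewrite -scaleN1r dotZr mulN1r. Qed.

Lemma dot_ge0 (R : realType) (m : nat) (u : 'cV[R]_m) : 0 <= dot u u.
Proof. by rewrite dotE; apply: sumr_ge0 => i _; rewrite -expr2 sqr_ge0. Qed.

Lemma dot_eq0 (R : realType) (m : nat) (u : 'cV[R]_m) : dot u u = 0 -> u = 0.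
Proof.
rewrite dotE => /eqP; rewrite psumr_eq0; last first.
  by move=> i _; rewrite -expr2 sqr_ge0.
move=> /allP h; apply/colP => i; rewrite mxE; apply/eqP.
by have := h i (mem_index_enum i); rewrite /= -expr2 sqrf_eq0.
Qed.

Lemma dot_cauchy_schwarz (R : realType) (m : nat) (u v : 'cV[R]_m) :
  dot u v <= Num.sqrt (dot u u) * Num.sqrt (dot v v).
Proof.
have [u0|u_n0] := eqVneq (dot u u) 0.
  by rewrite (dot_eq0 u0) -(scale0r 0) !dotZl !mul0r sqrtr0 mul0r.
have [v0|v_n0] := eqVneq (dot v v) 0.
  by rewrite (dot_eq0 v0) -(scale0r 0) !dotZr !mul0r sqrtr0 mulr0.
have hu : 0 < dot u u by rewrite lt_neqAle eq_sym u_n0 dot_ge0.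
have hv : 0 < dot v v by rewrite lt_neqAle eq_sym v_n0 dot_ge0.
set s := Num.sqrt (dot u u); set t := Num.sqrt (dot v v).
have s_gt0 : 0 < s by rewrite sqrtr_gt0.
have t_gt0 : 0 < t by rewrite sqrtr_gt0.
have sE : dot u u = s ^+ 2 by rewrite sqr_sqrtr // ltW.
have tE : dot v v = t ^+ 2 by rewrite sqr_sqrtr // ltW.
have := dot_ge0 (t *: u - s *: v).
rewrite !(dotDl, dotDr, dotNl, dotNr, dotZl, dotZr) (dotC v u) sE tE => h.
have : 0 <= (s * t) * (s * t - dot u v) by lra.
by rewrite pmulr_rge0 ?mulr_gt0 // subr_ge0.
Qed.

Lemma diag_mul (R : realType) (m : nat) (d : 'rV[R]_m) (v : 'cV[R]_m) i :
  (diag_mx d *m v) i 0 = d 0 i * v i 0.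
Proof. by rewrite mul_diag_mx mxE. Qed.

Lemma dot_diag (R : realType) (m : nat) (d : 'rV[R]_m) (u v : 'cV[R]_m) :
  dot (diag_mx d *m u) v = \sum_i d 0 i * u i 0 * v i 0.
Proof. by rewrite dotE; apply: eq_bigr => i _; rewrite diag_mul. Qed.

Lemma dot_diagC (R : realType) (m : nat) (d : 'rV[R]_m) (u v : 'cV[R]_m) :
  dot (diag_mx d *m u) v = dot (diag_mx d *m v) u.
Proof. by rewrite !dot_diag; apply: eq_bigr => i _; rewrite mulrAC. Qed.

Lemma dot_diag_ge0 (R : realType) (m : nat) (d : 'rV[R]_m) (v : 'cV[R]_m) :
  (forall i, 0 <= d 0 i) -> 0 <= dot (diag_mx d *m v) v.
Proof.
move=> d_ge0; rewrite dot_diag; apply: sumr_ge0 => i _.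
by rewrite -mulrA -expr2 mulr_ge0 ?sqr_ge0.
Qed.

Lemma dot_diag_eq0 (R : realType) (m : nat) (d : 'rV[R]_m) (v : 'cV[R]_m) :
  (forall i, 0 < d 0 i) -> dot (diag_mx d *m v) v = 0 -> v = 0.
Proof.
move=> d_gt0; rewrite dot_diag => /eqP; rewrite psumr_eq0; last first.
  by move=> i _; rewrite -mulrA -expr2 mulr_ge0 ?sqr_ge0 // ltW.
move=> /allP h; apply/colP => i; rewrite mxE; apply/eqP.
have := h i (mem_index_enum i).
by rewrite /= -mulrA -expr2 mulf_eq0 sqrf_eq0 gt_eqF.
Qed.

(** An upper bound for the inverses of the nonzero weights.  Zero weights
    contribute nothing because 0^-1 = 0; the summand 1 keeps the constant
    positive when all weights vanish. *)
Definition inv_weight (R : realType) (m : nat) (d : 'rV[R]_m) : R :=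
  1 + \sum_i (d 0 i)^-1.

Lemma inv_weight_gt0 (R : realType) (m : nat) (d : 'rV[R]_m) :
  (forall i, 0 <= d 0 i) -> 0 < inv_weight d.
Proof.
by move=> d_ge0; rewrite ltr_wpDr ?ltr01 ?sumr_ge0 // => i _; rewrite invr_ge0.
Qed.

Lemma dot_le_diag (R : realType) (m : nat) (d : 'rV[R]_m) (v : 'cV[R]_m) :
  (forall i, 0 <= d 0 i) -> (forall i, d 0 i = 0 -> v i 0 = 0) ->
  dot v v <= inv_weight d * dot (diag_mx d *m v) v.
Proof.
move=> d_ge0 v0; rewrite dotE dot_diag mulr_sumr; apply: ler_sum => i _.
have [d0|d_n0] := eqVneq (d 0 i) 0; first by rewrite v0 // !mulr0.
rewrite [leRHS](_ : _ = (inv_weight d * d 0 i) * (v i 0 * v i 0)); last by ring.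
apply: ler_peMl; first by rewrite -expr2 sqr_ge0.
rewrite -ler_pdivrMr; last by rewrite lt_neqAle eq_sym d_n0 d_ge0.
rewrite div1r /inv_weight (bigD1 i) //= addrCA lerDl addr_ge0 ?sumr_ge0 //.
by move=> j _; rewrite invr_ge0.
Qed.

(** A forcing term F enters the scheme as a functional v |-> (F, v), whereas
    its size is measured in the G-norm.  On the support of the weights both
    norms are equivalent, and one factor sqrt (inv_weight d) is lost for each
    of the two vectors. *)
Lemma dot_le_normG (R : realType) (m : nat) (d : 'rV[R]_m) (u v : 'cV[R]_m) :
  (forall i, 0 <= d 0 i) ->
  (forall i, d 0 i = 0 -> u i 0 = 0) -> (forall i, d 0 i = 0 -> v i 0 = 0) ->
  dot u v <= inv_weight d * normG (diag_mx d) u * normG (diag_mx d) v.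
Proof.
move=> d_ge0 u0 v0; have k_gt0 := inv_weight_gt0 d_ge0.
have k_ge0 := ltW k_gt0.
apply: le_trans (dot_cauchy_schwarz u v) _.
have bnd (w : 'cV[R]_m) : (forall i, d 0 i = 0 -> w i 0 = 0) ->
    Num.sqrt (dot w w) <= Num.sqrt (inv_weight d) * normG (diag_mx d) w.
  by move=> w0; rewrite -sqrtrM // ler_wsqrtr // dot_le_diag.
apply: le_trans (ler_pM _ _ (bnd u u0) (bnd v v0)) _; rewrite ?sqrtr_ge0 //.
rewrite mulrACA -expr2 sqr_sqrtr // mulrA; exact: lexx.
Qed.

(** * Stability of the explicit scheme by the energy method *)

(** Dividing by s + t, in a form which also covers s = t = 0. *)
Lemma diff_sqr_le (R : realType) (s t a : R) :
  0 <= t -> 0 <= a -> s ^+ 2 - t ^+ 2 <= a * (s + t) -> s <= t + a.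
Proof. by move=> t0 a0 h; case: (leP s (t + a)) => // hs; nra. Qed.

(** The energy of two consecutive iterates q, p.  The mixed term (A p, q), in
    place of the potential energy of one iterate, is what makes the balance
    of the three-level scheme exact. *)
Definition leapfrog_energy (R : realType) (m : nat) (G A : 'M[R]_m) (tau : R)
    (q p : 'cV[R]_m) : R :=
  (tau ^+ 2)^-1 * dot (G *m (p - q)) (p - q) + dot (A *m p) q.

Section Leapfrog.

Variables (R : realType) (m : nat) (W : 'cV[R]_m -> Prop).
Variables (G A : 'M[R]_m) (lmin lmax eps tau : R).
Hypothesis W_lin : forall a u v, W u -> W v -> W (a *: u + v).
Hypotheses (G_sym : symmetric_on W G) (A_sym : symmetric_on W A).
Hypothesis G_ge0 : forall v, W v -> 0 <= dot (G *m v) v.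
Hypotheses (lmin_gt0 : 0 < lmin) (lmax_gt0 : 0 < lmax).
Hypothesis spectral : forall v, W v ->
  lmin * dot (G *m v) v <= dot (A *m v) v /\
  dot (A *m v) v <= lmax * dot (G *m v) v.
Hypotheses (eps_gt0 : 0 < eps) (tau_gt0 : 0 < tau).
Hypothesis CFL : tau <= 2 / Num.sqrt ((1 + eps) * lmax).

Let WB u v : W u -> W v -> W (u - v).
Proof. by move=> Wu Wv; rewrite addrC -scaleN1r; apply: W_lin. Qed.

Let A_ge0 v : W v -> 0 <= dot (A *m v) v.
Proof.
move=> Wv; apply: le_trans (spectral Wv).1.
by rewrite mulr_ge0 ?G_ge0 // ltW.
Qed.

Let bil := (mulmxDr, mulmxN, dotDl, dotDr, dotNl, dotNr, dotZl, dotZr).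

(** The squared step restriction, with the factor (1 + eps) as the margin that
    the coercivity of the energy lives on. *)
Lemma CFL_sqr : (1 + eps) / 4 * lmax <= (tau ^+ 2)^-1.
Proof.
have L_gt0 : 0 < (1 + eps) * lmax by rewrite mulr_gt0 ?addr_gt0.
have sq_gt0 : 0 < Num.sqrt ((1 + eps) * lmax) by rewrite sqrtr_gt0.
have h : tau * Num.sqrt ((1 + eps) * lmax) <= 2 by rewrite -ler_pdivlMr.
have : (tau * Num.sqrt ((1 + eps) * lmax)) ^+ 2 <= 2 ^+ 2.
  by rewrite lerXn2r // nnegrE ?mulr_ge0 ?ltW.
rewrite exprMn sqr_sqrtr ?(ltW L_gt0) // => h2.
rewrite -[leRHS]mul1r ler_pdivlMr ?exprn_gt0 //; lra.
Qed.

Lemma kinetic_ge_potential v : W v ->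
  (1 + eps) / 4 * dot (A *m v) v <= (tau ^+ 2)^-1 * dot (G *m v) v.
Proof.
move=> Wv; have [_ hA] := spectral Wv.
apply: (@le_trans _ _ ((1 + eps) / 4 * lmax * dot (G *m v) v)).
  by rewrite -[leRHS]mulrA ler_wpM2l // divr_ge0 // addr_ge0 // ltW.
by rewrite ler_wpM2r ?G_ge0 // CFL_sqr.
Qed.

(** With s = p - q the energy is at least
    (1 + eps) / 4 (A s, s) + (A p, p) - (A p, s), a quadratic expression in s
    whose minimum, attained at s = 2 p / (1 + eps), is
    eps / (1 + eps) (A p, p). *)
Lemma potential_le_energy q p : W q -> W p ->
  eps * dot (A *m p) p <= (1 + eps) * leapfrog_energy G A tau q p.
Proof.
move=> Wq Wp; have Ws := WB Wp Wq.
have K := kinetic_ge_potential Ws.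
(* Positivity at the deviation from the minimizer is the completed square. *)
have S : 0 <= dot (A *m ((1 + eps) *: (p - q) - 2 *: p))
                  ((1 + eps) *: (p - q) - 2 *: p).
  apply: A_ge0; rewrite -scaleNr addrC; apply: W_lin => //.
  by rewrite -[_ *: _]addr0 -(subrr p); apply: W_lin => //; apply: WB.
have sym : dot (A *m (p - q)) p = dot (A *m p) (p - q).
  by rewrite (A_sym Ws Wp) dotC.
have Eq : leapfrog_energy G A tau q p = (tau ^+ 2)^-1 *
    dot (G *m (p - q)) (p - q) + dot (A *m p) p - dot (A *m p) (p - q).
  by rewrite /leapfrog_energy [dot (A *m p) (p - q)]dotDr dotNr; ring.
move: S; rewrite mulmxDr mulmxN -!scalemxAr.
rewrite (dotDl, dotNl) dotNl !dotDr !dotNr !dotZl !dotZr sym Eq => S.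
set g := (tau ^+ 2)^-1 * _ in K *.
have K' : (1 + eps) * ((1 + eps) / 4 * dot (A *m (p - q)) (p - q)) <= (1 + eps) * g.
  by rewrite ler_wpM2l // addr_ge0 // ltW.
lra.
Qed.

(** By polarization, (A p, q) = (A m, m) - (A s, s) / 4 with m = (p + q) / 2
    and s = p - q; the negative part is absorbed by the fraction
    1 / (1 + eps) of the kinetic energy. *)
Lemma kinetic_le_energy q p : W q -> W p ->
  eps * ((tau ^+ 2)^-1 * dot (G *m (p - q)) (p - q)) <=
  (1 + eps) * leapfrog_energy G A tau q p.
Proof.
move=> Wq Wp; have Ws := WB Wp Wq.
have K := kinetic_ge_potential Ws.
have S : 0 <= dot (A *m (p + q)) (p + q).
  by apply: A_ge0; rewrite -[p]scale1r; apply: W_lin.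
have sym : dot (A *m q) p = dot (A *m p) q by rewrite (A_sym Wq Wp) dotC.
have Eq : dot (A *m p) q =
    4^-1 * dot (A *m (p + q)) (p + q) - 4^-1 * dot (A *m (p - q)) (p - q).
  by rewrite !bil sym; field.
rewrite /leapfrog_energy Eq.
set g := (tau ^+ 2)^-1 * _ in K *.
have : 0 <= (1 + eps) * dot (A *m (p + q)) (p + q).
  by rewrite mulr_ge0 // addr_ge0 // ltW.
lra.
Qed.

(** The scheme tested with the centred difference p - r: symmetry makes both
    the inertial term (G (s - s'), s + s'), with s = p - q and s' = q - r, and
    the stiffness term (A q, p - r) telescope. *)
Lemma energy_balance r q p F : W r -> W q -> W p ->
  G *m ((tau ^+ 2)^-1 *: (p - q *+ 2 + r)) + A *m q = F ->
  leapfrog_energy G A tau q p - leapfrog_energy G A tau r q = dot F (p - r).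
Proof.
move=> Wr Wq Wp <-.
have sGpq : dot (G *m p) q = dot (G *m q) p by rewrite (G_sym Wp Wq) dotC.
have sGpr : dot (G *m p) r = dot (G *m r) p by rewrite (G_sym Wp Wr) dotC.
have sGqr : dot (G *m q) r = dot (G *m r) q by rewrite (G_sym Wq Wr) dotC.
have sApq : dot (A *m p) q = dot (A *m q) p by rewrite (A_sym Wp Wq) dotC.
rewrite /leapfrog_energy -scalemxAr mulr2n !bil sGpq sGpr sGqr sApq.
ring.
Qed.

Variable kappa : R.
Hypothesis kappa_gt0 : 0 < kappa.
Hypothesis dual : forall u v, W u -> W v ->
  dot u v <= kappa * normG G u * normG G v.

(* Each of the two coercivity estimates loses amp in norm. *)
Let amp := Num.sqrt ((1 + eps) / eps).

Let amp_ge0 : 0 <= amp. Proof. exact: sqrtr_ge0. Qed.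

Let ampE : amp ^+ 2 = (1 + eps) / eps.
Proof. by rewrite sqr_sqrtr // divr_ge0 ?addr_ge0 ?ltW. Qed.

Lemma energy_ge0 q p : W q -> W p -> 0 <= leapfrog_energy G A tau q p.
Proof.
move=> Wq Wp; have := potential_le_energy Wq Wp.
have e1 : 0 < 1 + eps by rewrite addr_gt0.
move=> /(le_trans (mulr_ge0 (ltW eps_gt0) (A_ge0 Wp))).
by rewrite pmulr_rge0.
Qed.

Lemma normG_diff_le q p : W q -> W p ->
  normG G (p - q) <= tau * amp * Num.sqrt (leapfrog_energy G A tau q p).
Proof.
move=> Wq Wp; have E0 := energy_ge0 Wq Wp.
have t2 : 0 < tau ^+ 2 by rewrite exprn_gt0.
rewrite -(@ger0_norm _ (tau * amp)) ?mulr_ge0 ?(ltW tau_gt0) // -sqrtr_sqr.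
rewrite -sqrtrM ?sqr_ge0 // ler_wsqrtr // exprMn ampE.
have := kinetic_le_energy Wq Wp.
rewrite mulrCA [_ * (eps * _)]mulrC ler_pdivrMr // -ler_pdivlMl //.
by move=> h; apply: le_trans h _; rewrite le_eqVlt; apply/orP; left; apply/eqP; ring.
Qed.

Lemma normG_le_energy q p : W q -> W p ->
  normG G p <= amp / Num.sqrt lmin * Num.sqrt (leapfrog_energy G A tau q p).
Proof.
move=> Wq Wp; have E0 := energy_ge0 Wq Wp.
rewrite mulrAC ler_pdivlMr ?sqrtr_gt0 // -!sqrtrM ?G_ge0 //; last first.
  by rewrite divr_ge0 ?addr_ge0 ?ltW.
rewrite ler_wsqrtr // mulrAC ler_pdivlMr // mulrC.
apply: le_trans (potential_le_energy Wq Wp).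
by rewrite ler_pM2l // mulrC (spectral Wp).1.
Qed.

(** Splitting p - r = (p - q) + (q - r) bounds the work of F by a multiple of
    the sum of the two square roots of energy, which then cancels against the
    same factor of the difference of energies. *)
Lemma sqrt_energy_step r q p F : W r -> W q -> W p -> W F ->
  G *m ((tau ^+ 2)^-1 *: (p - q *+ 2 + r)) + A *m q = F ->
  Num.sqrt (leapfrog_energy G A tau q p) <=
  Num.sqrt (leapfrog_energy G A tau r q) + kappa * amp * (tau * normG G F).
Proof.
move=> Wr Wq Wp WF scheme.
have nF : 0 <= normG G F by exact: sqrtr_ge0.
have kF : 0 <= kappa * normG G F by rewrite mulr_ge0 // ltW.
apply: diff_sqr_le; first exact: sqrtr_ge0.
  by rewrite !mulr_ge0 // ltW.
rewrite !sqr_sqrtr ?energy_ge0 // (energy_balance Wr Wq Wp scheme).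
rewrite -(subrKA q) dotDr.
have h1 := dual WF (WB Wp Wq); have h2 := dual WF (WB Wq Wr).
have k1 := ler_wpM2l kF (normG_diff_le Wq Wp).
have k2 := ler_wpM2l kF (normG_diff_le Wr Wq).
lra.
Qed.

(** Both factors amp are present: one converts the force into energy growth,
    the other recovers the solution from its energy. *)
Lemma leapfrog_stability (u F : nat -> 'cV[R]_m) :
  (forall k, W (u k)) -> (forall k, W (F k)) -> u 0%N = 0 -> u 1%N = 0 ->
  (forall k, (1 <= k)%N ->
     G *m ((tau ^+ 2)^-1 *: (u k.+1 - u k *+ 2 + u k.-1)) + A *m u k = F k) ->
  forall k, normG G (u k.+1) <=
    kappa * amp * amp / Num.sqrt lmin *
    \sum_(1 <= i < k.+1) tau * normG G (F i).
Proof.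
move=> Wu WF u0 u1 scheme k.
apply: le_trans (normG_le_energy (Wu k) (Wu k.+1)) _.
have -> : kappa * amp * amp / Num.sqrt lmin =
  (amp / Num.sqrt lmin) * (kappa * amp) by ring.
rewrite -[leRHS]mulrA ler_wpM2l ?divr_ge0 ?sqrtr_ge0 //.
elim: k => [|k IHk].
  rewrite u0 u1 /leapfrog_energy subr0 !mulmx0 -(scale0r 0) !dotZl !mul0r.
  by rewrite mulr0 addr0 sqrtr0 big_geq // mulr0.
rewrite big_nat_recr //= mulrDr.
apply: le_trans (sqrt_energy_step (Wu k) (Wu k.+1) (Wu k.+2) (WF k.+1) _) _.
  exact: (scheme k.+1).
by rewrite lerD2r.
Qed.

End Leapfrog.

(** * The Dirichlet operator *)

Lemma Vspace_lin (R : realType) (n : nat) (a : R) (u v : 'cV[R]_n.+2) :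
  Vspace u -> Vspace v -> Vspace (a *: u + v).
Proof. by move=> [u0 u1] [v0 v1]; split; rewrite !mxE ?(u0, u1, v0, v1) mulr0 addr0. Qed.

Lemma Vspace_Rmx (R : realType) (n : nat) (w : 'cV[R]_n.+2) :
  Vspace (Rmx R n *m w).
Proof. by split; rewrite diag_mul mxE eqxx ?orbT mul0r. Qed.

Lemma Rmx_id (R : realType) (n : nat) (v : 'cV[R]_n.+2) :
  Vspace v -> Rmx R n *m v = v.
Proof.
move=> [v0 v1]; apply/colP => i; rewrite diag_mul mxE.
case: eqP => [->|_] /=; first by rewrite v0 mulr0.
by case: eqP => [->|_]; rewrite ?v1 ?mulr0 ?mul1r.
Qed.

Lemma dot_Rmx (R : realType) (n : nat) (w v : 'cV[R]_n.+2) :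
  Vspace v -> dot (Rmx R n *m w) v = dot w v.
Proof. by move=> Vv; rewrite dot_diagC Rmx_id // dotC. Qed.

(** The boundary terms of summation by parts carry the end values of v, so on
    V the operator - D^- is the H-adjoint of D^+. *)
Lemma SBP_Vspace (R : realType) (n : nat) (H Dp Dm : 'M[R]_n.+2)
    (w v : 'cV[R]_n.+2) :
  SBP H Dp Dm -> Vspace v ->
  dot (H *m (Dm *m w)) v = - dot (H *m w) (Dp *m v).
Proof.
move=> hSBP [v0 v1]; have := hSBP w v; rewrite v0 v1 !mulr0 oppr0 addr0.
rewrite /dotH -!mulmxA -/(dot _ _) -/(dot _ _) => /eqP.
by rewrite addrC addr_eq0 => /eqP.
Qed.

Lemma dot_Amx (R : realType) (n : nat) (H P C Dp Dm : 'M[R]_n.+2)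
    (u v : 'cV[R]_n.+2) :
  SBP H Dp Dm -> Vspace u -> Vspace v ->
  dot (Amx H P C Dp Dm *m u) v =
  dot ((H *m P *m C ^+ 2) *m (Dp *m u)) (Dp *m v).
Proof.
move=> hSBP Vu Vv; rewrite /Amx mulNmx dotNl -!mulmxA dot_Rmx // (Rmx_id Vu).
by rewrite (SBP_Vspace _ hSBP) // opprK !mulmxA.
Qed.

Theorem theorem1 (R : realType) (n : nat)
    (x : 'I_n.+2 -> R) (rho c : R -> R) (H Dp Dm : 'M[R]_n.+2)
    (hx : is_grid x)
    (hrho : smooth01 rho) (hc : smooth01 c)
    (hrho_pos : forall y : R, 0 <= y <= 1 -> 0 < rho y)
    (hc_pos : forall y : R, 0 <= y <= 1 -> 0 < c y)
    (hH : is_diag_mx H) (hH_pos : forall i : 'I_n.+2, 0 < H i i)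
    (hSBP : SBP H Dp Dm)
    (hker : kernel_is_constants Dp) :
  let P := grid_diag x rho in
  let C := grid_diag x c in
  let G := Gmx H P in
  let A := Amx H P C Dp Dm in
  symmetric_on (@Vspace R n) A /\
  posdef_on (@Vspace R n) A /\
  forall lmin lmax : R,
    0 < lmin -> lmin <= lmax ->
    (forall v : 'cV[R]_n.+2, Vspace v ->
       lmin * dot (G *m v) v <= dot (A *m v) v /\
       dot (A *m v) v <= lmax * dot (G *m v) v) ->
    forall eps : R, 0 < eps ->
    exists K : R, 0 < K /\
      forall (f : R -> 'cV[R]_n.+2) (aL aR : R -> R) (tau : R)
             (u : nat -> 'cV[R]_n.+2),
        let F := rhs H P C Dp Dm f aL aR in
        0 < tau ->
        tau <= 2 / Num.sqrt ((1 + eps) * lmax) ->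
        explicit_scheme G A F tau u ->
        forall k : nat, (1 <= k)%N ->
          normG G (u k.+1) <=
            K / lmin * Num.sqrt ((1 + eps) / eps) *
            \sum_(1 <= i < k.+1) tau * normG G (F (i%:R * tau)).
Proof.
move=> P C G A.
have x01 i : 0 <= x i <= 1.
  case: hx => x0 x1 xlt; apply/andP; split.
    have [->|i_n0] := eqVneq i ord0; first by rewrite x0.
    by rewrite -x0 ltW // xlt // lt0n.
  have [->|i_nm] := eqVneq i ord_max; first by rewrite x1.
  by rewrite -x1 ltW // xlt //= ltn_neqAle -ltnS ltn_ord andbT.
have rho_gt0 i : 0 < rho (x i) by apply: hrho_pos.
have c_gt0 i : 0 < c (x i) by apply: hc_pos.
have HE : H = diag_mx (\row_i H i i).
  apply/matrixP => i j; rewrite !mxE; case: eqP => [->|ij] /=.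
    by rewrite mulr1n.
  rewrite mulr0n; move/is_diag_mxP: hH; apply; by apply/eqP => /val_inj.
pose w : 'rV[R]_n.+2 := \row_i (H i i * rho (x i) * c (x i) ^+ 2).
have WE : H *m P *m C ^+ 2 = diag_mx w.
  rewrite HE expr2 -mulmxE !mulmx_diag; congr diag_mx.
  by apply/rowP => i; rewrite !mxE expr2 !mulrA.
have w_gt0 i : 0 < w 0 i by rewrite mxE !mulr_gt0 ?exprn_gt0.
pose interior (i : 'I_n.+2) : R :=
  if (i == ord0) || (i == ord_max) then 0 else 1.
pose g : 'rV[R]_n.+2 := \row_i (interior i * H i i * rho (x i)).
have GE : G = diag_mx g.
  rewrite /G /Gmx HE !mulmx_diag; congr diag_mx.
  by apply/rowP => i; rewrite !mxE.
have g_ge0 i : 0 <= g 0 i.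
  by rewrite mxE /interior; case: ifP => _; rewrite ?mul0r ?mul1r // ltW ?mulr_gt0.
have g_eq0 (v : 'cV[R]_n.+2) : Vspace v -> forall i, g 0 i = 0 -> v i 0 = 0.
  move=> [v0 v1] i; rewrite mxE /interior.
  case: eqP => [->|_] //=; case: eqP => [->|_] //=.
  by move/eqP; rewrite mul1r gt_eqF // mulr_gt0.
have A_sym : symmetric_on (@Vspace R n) A.
  move=> u v Vu Vv; rewrite (dotC u) !dot_Amx // WE; exact: dot_diagC.
split=> //; split=> [v Vv v_n0|lmin lmax lmin_gt0 le_l spectral eps eps_gt0].
  rewrite dot_Amx // WE lt_neqAle dot_diag_ge0 ?andbT; last first.
    by move=> i; rewrite ltW.
  rewrite eq_sym; apply: contra v_n0 => /eqP /(dot_diag_eq0 w_gt0) /hker [a va].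
  by case: Vv => + _; rewrite va mxE => ->; apply/eqP/colP => i; rewrite !mxE.
pose amp := Num.sqrt ((1 + eps) / eps).
have amp_gt0 : 0 < amp by rewrite sqrtr_gt0 divr_gt0 ?addr_gt0.
have k_gt0 := inv_weight_gt0 g_ge0.
exists (inv_weight g * amp * Num.sqrt lmin); split.
  by rewrite !mulr_gt0 // sqrtr_gt0.
move=> f aL aR tau u F tau_gt0 CFL [Vu u0 u1 scheme] k _.
have VF t : Vspace (F t).
  rewrite /F /rhs -!mulmxA -[Rmx R n *m _]scale1r.
  by apply: Vspace_lin; apply: Vspace_Rmx.
(* The factor sqrt lmin in K compensates for lmin standing in place of its
   square root in the required bound. *)
have lE : inv_weight g * amp * Num.sqrt lmin / lmin * amp =
    inv_weight g * amp * amp / Num.sqrt lmin.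
  have s_n0 : Num.sqrt lmin != 0 by rewrite gt_eqF // sqrtr_gt0.
  by rewrite -{2}(sqr_sqrtr (ltW lmin_gt0)); field.
rewrite -/amp lE.
apply: (leapfrog_stability (@Vspace_lin R n) _ A_sym _ lmin_gt0 _ spectral
          eps_gt0 tau_gt0 CFL k_gt0 _ Vu (fun i => VF (i%:R * tau)) u0 u1 scheme).
- by move=> p q _ _; rewrite GE (dotC p) dot_diagC.
- by move=> v _; rewrite GE dot_diag_ge0.
- exact: lt_le_trans le_l.
- move=> p q Vp Vq; rewrite GE; apply: dot_le_normG => //; exact: g_eq0.
Qed.
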